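(* If a bounded representation of a group $\Gamma$ by operators in a real Hilbert space $\mathcal{H}$ preserves a sesquilinear form with finite number of negative squares, then it is similar to an orthogonal representation of $\Gamma$ on $\mathcal{H}$.
   Context: A representation $\pi$ of $\Gamma$ by bounded operators on $\mathcal{H}$ is bounded if $\sup_{g\in\Gamma}\|\pi(g)\|<\infty$. A representation $\pi$ of $\Gamma$ in a real Hilbert space $\mathcal{H}$ preserves a sesquilinear form with finite number of negative squares if $\mathcal{H}$ can be decomposed into the orthogonal sum of subspaces $H$ and $K$ with $\dim K<\infty$ in such a way that $$(P_H\pi(g)x,\pi(g)y)-(P_K\pi(g)x,\pi(g)y)=(P_Hx,y)-(P_Kx,y)$$ for all $x,y\in\mathcal{H}$ and all $g\in\Gamma$, where $P_H,P_K$ are the orthogonal projections onto $H$ and $K$. A representation $\pi$ is similar to a representation $\tau$ on $\mathcal{H}$ if there is a bounded invertible operator $U$ on $\mathcal{H}$ with $\tau(g)=U^{-1}\pi(g)U$ for all $g\in\Gamma$. A representation is orthogonal if all its operators are orthogonal (surjective and preserving the scalar product of $\mathcal{H}$). *)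

(* Defs.v *)
From HB Require Import structures.
From mathcomp Require Import all_boot all_order all_algebra.
From mathcomp Require Import all_classical all_reals all_analysis.

Set Implicit Arguments.
Unset Strict Implicit.
Unset Printing Implicit Defensive.
Import Order.TTheory GRing.Theory Num.Theory.
Import numFieldNormedType.Exports.

Local Open Scope classical_set_scope.
Local Open Scope ring_scope.

(* A real Hilbert space: a Banach space over R whose norm comes from an inner
   product.  [{symmetric V}] is the library type of symmetric bilinear forms;
   positive definiteness follows from [inner_norm]. *)
HB.mixin Record CompleteNormedModule_isHilbert (R : realType) V
    & CompleteNormedModule R V := {
  inner : {symmetric V} ;
  inner_norm : forall x : V, inner x x = `|x| ^+ 2
}.

#[short(type="hilbertType")]
HB.structure Definition Hilbert (R : realType) :=
  {V of CompleteNormedModule R V & CompleteNormedModule_isHilbert R V}.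

Section Operators.
Context {R : realType} {V : normedModType R}.

Definition opnorm (T : V -> V) : \bar R :=
  ereal_sup [set `|T x|%:E | x in [set x : V | `|x| <= 1]].

Definition bounded_operator (T : {linear V -> V}) : Prop :=
  (opnorm T < +oo)%E.

End Operators.

Record representation (R : realType) (G : groupType) (V : normedModType R) :=
  Representation {
    rep_op :> G -> {linear V -> V} ;
    rep_bounded : forall g, bounded_operator (rep_op g) ;
    rep1 : forall x, rep_op 1%g x = x ;
    repM : forall g h x, rep_op (g * h)%g x = rep_op g (rep_op h x)
  }.

Section Representations.
Context {R : realType} {G : groupType} {V : hilbertType R}.
Implicit Types (pi tau : representation G V) (M N : set V).

Definition bounded_representation pi : Prop :=
  (ereal_sup (range (fun g => opnorm (pi g))) < +oo)%E.

Definition finite_dimensional M : Prop :=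
  exists (n : nat) (e : 'I_n -> V),
    M = range (fun c : 'I_n -> R => \sum_(i < n) c i *: e i).

(* Closedness of [M] and [N] need not be required: each of them is the
   orthogonal complement of the other. *)
Definition orthogonal_sum M N : Prop :=
  [/\ GRing.submod_closed [in M], GRing.submod_closed [in N],
      forall x y, M x -> N y -> inner x y = 0 &
      forall z, exists x y, [/\ M x, N y & z = x + y]].

Definition is_orthogonal_projection M (P : V -> V) : Prop :=
  forall x, M (P x) /\ forall y, M y -> inner (x - P x) y = 0.

Definition preserves_form_with_finite_negative_squares pi : Prop :=
  exists (H K : set V) (PH PK : V -> V),
    [/\ orthogonal_sum H K, finite_dimensional K,
        is_orthogonal_projection H PH, is_orthogonal_projection K PK &
        forall x y g,
          inner (PH (pi g x)) (pi g y) - inner (PK (pi g x)) (pi g y) =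
          inner (PH x) y - inner (PK x) y].

Definition similar_representations pi tau : Prop :=
  exists U Uinv : {linear V -> V},
    [/\ bounded_operator U, bounded_operator Uinv,
        cancel U Uinv, cancel Uinv U &
        forall g x, tau g x = Uinv (pi g (U x))].

Definition orthogonal_operator (T : V -> V) : Prop :=
  range T = [set: V] /\ forall x y, inner (T x) (T y) = inner x y.

Definition orthogonal_representation pi : Prop :=
  forall g, orthogonal_operator (pi g).

End Representations.

(* Main.v *)
Require Import Defs.
From HB Require Import structures.
From mathcomp Require Import all_boot all_order all_algebra.
From mathcomp Require Import all_classical all_reals all_analysis.
From mathcomp Require Import ring lra.

(** Write J = P_H - P_K for the symmetry defining the indefinite form
    [x, y] = (J x, y), and let M bound all the norms of the operators of the
    group.  For the representation pi and g in the group,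

      |pi(g)^-1 x|^2 = [x, x] + 2 |P_K pi(g)^-1 x|^2,

    since pi(g) preserves [ , ].  So adding to the fixed form [ , ] twice the
    quadratic form x |-> |P_K pi(g)^-1 x|^2 gives a form between M^-2 |x|^2 and
    M^2 |x|^2.  The point of finite negative index is that these correction
    forms have finite rank, hence lie in a Hilbert space, that of
    Hilbert-Schmidt tensors: as forms in J x, they make up the orbit of P_K
    under the action of the group by b (x) b |-> pi(g) b (x) pi(g) b.  This
    action is bounded, and a bounded action on a Hilbert space fixes a point of
    every nonempty invariant closed convex set: N(s) = sup_g |g s|^2 is
    invariant and, as a supremum of squared Hilbert norms uniformly equivalent
    to each other, uniformly convex, so it has only one minimizer.  A fixed
    tensor yields an invariant form (A x, y) with
    c |x|^2 <= (A x, x) <= C |x|^2, and conjugating pi by a square root of A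
    turns it into an orthogonal representation.

    Tensors are formal finite sums of c b (x) b, given as lists of pairs
    (c, b).  The Hilbert-Schmidt product extends to them by a finite formula;
    all that is needed of it is its positivity, the boundedness of the action
    ([hs_push]) and its control of the associated operators
    ([tensor_op_norm]), which all come from the Schur product theorem
    ([schur_product]).  The minimization then produces a sequence of formal
    tensors ([almost_invariant_tensors]), whose operators converge. *)

Set Implicit Arguments.
Unset Strict Implicit.
Unset Printing Implicit Defensive.
Import Order.TTheory GRing.Theory Num.Theory.
Import numFieldNormedType.Exports.

Local Open Scope classical_set_scope.
Local Open Scope ring_scope.

Local Notation "''[' x , y ]" := (inner x y) : ring_scope.

(** * Inner products *)

Section InnerProduct.
Context {R : realType} {V : hilbertType R}.
Implicit Types (x y z : V) (a : R).

Lemma innerC x y : '[x, y] = '[y, x].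
Proof. by rewrite hermC expr0 mul1r. Qed.

Lemma innerDl x y z : '[x + y, z] = '[x, z] + '[y, z].
Proof. exact: linearDl. Qed.

Lemma innerDr x y z : '[z, x + y] = '[z, x] + '[z, y].
Proof. exact: linearDr. Qed.

Lemma innerNl x z : '[- x, z] = - '[x, z].
Proof. exact: linearNl. Qed.

Lemma innerNr x z : '[z, - x] = - '[z, x].
Proof. exact: linearNr. Qed.

Lemma innerZl a x z : '[a *: x, z] = a * '[x, z].
Proof. exact: linearZl_LR. Qed.

Lemma innerZr a x z : '[z, a *: x] = a * '[z, x].
Proof. by rewrite innerC innerZl innerC. Qed.

Lemma inner0l z : '[0, z] = 0.
Proof. exact: linear0l. Qed.

Lemma inner0r z : '[z, 0] = 0.
Proof. exact: linear0r. Qed.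

Definition innerE := (innerDl, innerDr, innerNl, innerNr, innerZl, innerZr).

Lemma inner_suml I (r : seq I) (F : I -> V) z :
  '[\sum_(i <- r) F i, z] = \sum_(i <- r) '[F i, z].
Proof. exact: linear_sumlz. Qed.

Lemma inner_sumr I (r : seq I) (F : I -> V) z :
  '[z, \sum_(i <- r) F i] = \sum_(i <- r) '[z, F i].
Proof. exact: linear_sumr. Qed.

Lemma inner_ge0 x : 0 <= '[x, x].
Proof. by rewrite inner_norm sqr_ge0. Qed.

Lemma inner_eq0 x : '[x, x] = 0 -> x = 0.
Proof. by rewrite inner_norm => /eqP; rewrite sqrf_eq0 normr_eq0 => /eqP. Qed.

(** The source of the Cauchy-Schwarz inequality of every positive form,
    degenerate ones included. *)
Lemma discriminant_le0 (a b c : R) : 0 <= a -> 0 <= c ->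
  (forall t, 0 <= a + 2 * t * b + t ^+ 2 * c) -> b ^+ 2 <= a * c.
Proof.
move=> a0 c0 h; have [cz|cn] := eqVneq c 0.
  have [->|bn] := eqVneq b 0; first by rewrite expr0n /= mulr_ge0.
  (* this value of t makes the polynomial, then affine, equal to -1 *)
  have := h (- (a + 1) / (2 * b)); rewrite cz.
  have -> : a + 2 * (- (a + 1) / (2 * b)) * b + (- (a + 1) / (2 * b)) ^+ 2 * 0
          = -1 by field.
  by rewrite lerNr oppr0 ler10.
have {cn} cgt0 : 0 < c by rewrite lt_def cn.
have := mulr_ge0 c0 (h (- b / c)).
have -> : c * (a + 2 * (- b / c) * b + (- b / c) ^+ 2 * c) = a * c - b ^+ 2.
  by field; rewrite gt_eqF.
by rewrite subr_ge0.
Qed.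

Lemma inner_cauchy_schwarz x y : '[x, y] ^+ 2 <= '[x, x] * '[y, y].
Proof.
apply: discriminant_le0; [exact: inner_ge0|exact: inner_ge0|move=> a].
have := inner_ge0 (x + a *: y); rewrite !innerE (innerC y x).
by congr (0 <= _); ring.
Qed.

Lemma inner_inj x y : (forall z, '[x, z] = '[y, z]) -> x = y.
Proof.
move=> h; apply/eqP; rewrite -subr_eq0; apply/eqP/inner_eq0.
by rewrite innerDl innerNl h subrr.
Qed.

End InnerProduct.

(** * Positive kernels and the Schur product *)

Section PositiveKernels.
Context {R : realType} {V : hilbertType R}.

Definition positive_kernel (I : Type) (k : I -> I -> R) : Prop :=
  forall s : seq (R * I),
    0 <= \sum_(p <- s) \sum_(q <- s) p.1 * q.1 * k p.2 q.2.

Lemma gram_positive (I : Type) (v : I -> V) :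
  positive_kernel (fun i j => '[v i, v j]).
Proof.
move=> s; have := inner_ge0 (\sum_(p <- s) p.1 *: v p.2).
rewrite inner_suml; under eq_bigr do rewrite inner_sumr.
by under eq_bigr do under eq_bigr do rewrite innerZl innerZr mulrA.
Qed.

(** The pointwise product of a positive kernel with a Gram kernel is positive.
    Split off from all the vectors their components along one of them: those
    contribute a positive multiple of a value of [k], and the remainders are
    again vectors, one of which has become 0, whence the induction.  The
    vectors stay indexed by [I], so that repeated indices do no harm. *)
Lemma schur_product (I : Type) (k : I -> I -> R) (v : I -> V) :
  positive_kernel k -> positive_kernel (fun i j => k i j * '[v i, v j]).
Proof.
move=> kpos s; elim: s v => [|[c i0] s IHs] v; first by rewrite big_nil.
pose e := v i0.
have [al [w [wo w0 vE]]] : exists al : I -> R, exists w : I -> V,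
    [/\ forall i, '[w i, e] = 0, w i0 = 0 & forall i, v i = al i *: e + w i].
  pose al i := '[v i, e] / '[e, e]; exists al, (fun i => v i - al i *: e).
  have wo i : '[v i - al i *: e, e] = 0.
    rewrite /al !innerE; have [/inner_eq0 ->|e0] := eqVneq '[e, e] 0.
      by rewrite !inner0r mulr0 subr0.
    by rewrite divfK // subrr.
  split=> [//||i]; last by rewrite addrC subrK.
  apply: inner_eq0; rewrite -[X in '[_, X - _]]/e innerDr innerNr innerZr.
  by rewrite !wo mulr0 subr0.
have dec i j : '[v i, v j] = al i * al j * '[e, e] + '[w i, w j].
  by rewrite (vE i) (vE j) !innerE wo (innerC e) wo; ring.
have := kpos [seq (p.1 * al p.2, p.2) | p <- (c, i0) :: s].
rewrite big_map; under eq_bigr do rewrite big_map.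
move/(mulr_ge0 (inner_ge0 e)); move/addr_ge0; move/(_ _ (IHs w)).
suff -> : \sum_(p <- s) \sum_(q <- s) p.1 * q.1 * (k p.2 q.2 * '[w p.2, w q.2])
  = \sum_(p <- (c, i0) :: s) \sum_(q <- (c, i0) :: s)
      p.1 * q.1 * (k p.2 q.2 * '[w p.2, w q.2]).
  rewrite mulr_sumr -big_split /= => h; apply: le_trans h _.
  apply: ler_sum => p _; rewrite mulr_sumr -big_split /=.
  by apply: ler_sum => q _; rewrite (dec p.2); lra.
rewrite big_cons /= big_cons /= w0 inner0l !mulr0 add0r.
rewrite [X in X + _]big1 ?add0r; last by move=> q _; rewrite inner0l !mulr0.
by apply: eq_bigr => p _; rewrite big_cons /= w0 inner0r !mulr0 add0r.
Qed.

End PositiveKernels.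

(** * Formal symmetric tensors *)

Section Tensors.
Context {R : realType} {V : hilbertType R}.
Implicit Types (s t : seq (R * V)) (x y : V).

(** The Hilbert-Schmidt inner product of the tensors sum c b (x) b, of which
    the lists of pairs (c, b) are formal expressions. *)
Definition hs s t : R :=
  \sum_(p <- s) \sum_(q <- t) p.1 * q.1 * '[p.2, q.2] ^+ 2.

Definition scale a s := [seq (a * p.1, p.2) | p <- s].

Definition push (f : V -> V) s := [seq (p.1, f p.2) | p <- s].

Definition tensor_op s x := \sum_(p <- s) (p.1 * '[p.2, x]) *: p.2.

Lemma hsC s t : hs s t = hs t s.
Proof.
rewrite /hs exchange_big; apply: eq_bigr => p _; apply: eq_bigr => q _ /=.
by rewrite innerC (mulrC p.1).
Qed.

Lemma hs_catl s1 s2 t : hs (s1 ++ s2) t = hs s1 t + hs s2 t.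
Proof. exact: big_cat. Qed.

Lemma hs_catr s1 s2 t : hs t (s1 ++ s2) = hs t s1 + hs t s2.
Proof. by rewrite hsC hs_catl !(hsC _ t). Qed.

Lemma hs_scalel a s t : hs (scale a s) t = a * hs s t.
Proof.
rewrite /hs big_map mulr_sumr; apply: eq_bigr => p _.
by rewrite mulr_sumr; apply: eq_bigr => q _ /=; ring.
Qed.

Lemma hs_scaler a s t : hs s (scale a t) = a * hs s t.
Proof. by rewrite hsC hs_scalel hsC. Qed.

Definition hsE := (hs_catl, hs_catr, hs_scalel, hs_scaler).

Lemma hs_ge0 s : 0 <= hs s s.
Proof.
have := schur_product (fun x => x) (gram_positive (fun x : V => x)) s.
by congr (0 <= _); apply: eq_bigr => p _; apply: eq_bigr => q _; rewrite expr2.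
Qed.

(** The map b (x) b |-> f b (x) f b is bounded for the Hilbert-Schmidt norm.
    The kernel M^2 (x, y) - (f x, f y) is positive; multiplying it by the Gram
    kernels of the vectors and of their images bounds the action on one tensor
    factor after the other. *)
Lemma hs_push (f : {linear V -> V}) (M : R) s :
    (forall x, `|f x| <= M * `|x|) ->
  hs (push f s) (push f s) <= M ^+ 4 * hs s s.
Proof.
move=> fM; pose k x y := M ^+ 2 * '[x, y] - '[f x, f y].
have kpos : positive_kernel k.
  move=> r; pose z : V := \sum_(p <- r) p.1 *: p.2.
  have -> : \sum_(p <- r) \sum_(q <- r) p.1 * q.1 * k p.2 q.2
          = M ^+ 2 * '[z, z] - '[f z, f z].
    have -> : f z = \sum_(p <- r) p.1 *: f p.2.
      by rewrite linear_sum; apply: eq_bigr => p _; rewrite linearZ.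
    rewrite /z !inner_suml mulr_sumr -sumrB.
    apply: eq_bigr => p _; rewrite !inner_sumr mulr_sumr -sumrB.
    by apply: eq_bigr => q _; rewrite !innerE /k; ring.
  rewrite subr_ge0 !inner_norm -exprMn lerXn2r ?nnegrE ?normr_ge0 //.
  exact: le_trans (fM z).
have h1 := mulr_ge0 (sqr_ge0 M) (schur_product (fun x => x) kpos s).
have h2 := schur_product f kpos s.
rewrite -subr_ge0; apply: le_trans (addr_ge0 h1 h2) _; rewrite le_eqVlt.
apply/orP; left; apply/eqP; rewrite /hs big_map !mulr_sumr -sumrN.
rewrite -!big_split; apply: eq_bigr => p _ /=.
rewrite big_map !mulr_sumr -sumrN -!big_split /=.
by apply: eq_bigr => q _; rewrite /k; ring.
Qed.

Lemma inner_tensor_op s x y :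
  '[tensor_op s x, y] = \sum_(p <- s) p.1 * '[p.2, x] * '[p.2, y].
Proof. by rewrite inner_suml; apply: eq_bigr => p _; rewrite innerZl. Qed.

Lemma tensor_op_cat s t x :
  tensor_op (s ++ t) x = tensor_op s x + tensor_op t x.
Proof. exact: big_cat. Qed.

Lemma tensor_op_scale a s x : tensor_op (scale a s) x = a *: tensor_op s x.
Proof.
rewrite /tensor_op big_map scaler_sumr.
by apply: eq_bigr => p _; rewrite scalerA mulrA.
Qed.

Lemma tensor_op_linear s : linear (tensor_op s).
Proof.
move=> a x y; rewrite /tensor_op scaler_sumr -big_split /=.
apply: eq_bigr => p _; rewrite scalerA -scalerDl !innerE.
by congr (_ *: _); ring.
Qed.

Lemma hs_cauchy_schwarz s t : hs s t ^+ 2 <= hs s s * hs t t.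
Proof.
apply: discriminant_le0; [exact: hs_ge0|exact: hs_ge0|move=> a].
have := hs_ge0 (s ++ scale a t); rewrite !hsE (hsC t s).
by congr (0 <= _); ring.
Qed.

(** The operator norm is at most the Hilbert-Schmidt norm: if w is the image
    of x, then (w, w) is the product of the tensor with x (x) w, made symmetric
    by polarization so as to stay among sums of c b (x) b. *)
Lemma tensor_op_norm s x : `|tensor_op s x| ^+ 2 <= hs s s * `|x| ^+ 2.
Proof.
rewrite -!inner_norm; set w := tensor_op s x.
have [->|w0] := eqVneq '[w, w] 0; first by rewrite mulr_ge0 ?hs_ge0 ?inner_ge0.
have {w0} wgt0 : 0 < '[w, w] by rewrite lt_def w0 inner_ge0.
(* t is 2 (x (x) w + w (x) x) *)
pose t : seq (R * V) := [:: (1, x + w); (-1, x - w)].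
have st : hs s t = 4 * '[w, w].
  rewrite {1}/w inner_tensor_op mulr_sumr; apply: eq_bigr => p _.
  by rewrite !big_cons big_nil /= !innerE; ring.
have tt : hs t t = 8 * ('[x, x] * '[w, w]) + 8 * '[x, w] ^+ 2.
  by rewrite /hs !(big_cons, big_nil) /= !innerE (innerC w x); ring.
have := hs_cauchy_schwarz s t; rewrite st tt => h.
have h2 := inner_cauchy_schwarz x w; have h3 := hs_ge0 s.
have := ler_wpM2l h3 h2 => h4.
rewrite -(ler_pM2r wgt0); nra.
Qed.

End Tensors.

(** * Limits of operators *)

Section OperatorLimits.
Context {R : realType} {V : hilbertType R}.
Implicit Types (x y z : V).

Lemma inner_norm_le x y : `|'[x, y]| <= `|x| * `|y|.
Proof.
rewrite -(ler_pXn2r (n := 2)) ?nnegrE ?mulr_ge0 // real_normK ?num_real //.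
by rewrite exprMn -!inner_norm inner_cauchy_schwarz.
Qed.

Lemma lipschitz_cvg (W W' : normedModType R) (K : R) (u : nat -> W)
    (v : nat -> W') (l : W) (l' : W') :
    0 <= K -> (forall n, `|l' - v n| <= K * `|l - u n|) ->
  u n @[n --> \oo] --> l -> v n @[n --> \oo] --> l'.
Proof.
move=> K0 vu /cvgrPdist_le ul; apply/cvgrPdist_le => /= e e0.
have K1 : 0 < K + 1 by rewrite ltr_wpDl.
near=> n; apply: le_trans (vu n) _.
have : `|l - u n| <= e / (K + 1) by near: n; apply: ul; rewrite divr_gt0.
rewrite ler_pdivlMr // mulrC; apply: le_trans.
by rewrite ler_wpM2r // lerDl.
Unshelve. all: by end_near. Qed.

Lemma inner_cvgl (u : nat -> V) l y :
  u n @[n --> \oo] --> l -> '[u n, y] @[n --> \oo] --> '[l, y].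
Proof.
apply: (lipschitz_cvg (normr_ge0 y)) => n.
by rewrite -innerNl -innerDl mulrC inner_norm_le.
Qed.

Lemma bounded_linear_cvg (T : {linear V -> V}) (K : R) (u : nat -> V) l :
    0 <= K -> (forall x, `|T x| <= K * `|x|) ->
  u n @[n --> \oo] --> l -> T (u n) @[n --> \oo] --> T l.
Proof.
by move=> K0 TK; apply: (lipschitz_cvg K0) => n; rewrite -linearB.
Qed.

Lemma limit_unique (W : normedModType R) (u : nat -> W) (l l' : W) :
  u n @[n --> \oo] --> l -> u n @[n --> \oo] --> l' -> l = l'.
Proof. by move=> ul ul'; rewrite -(norm_cvg_lim ul) (norm_cvg_lim ul'). Qed.

Lemma limit_norm_le (u : nat -> V) l (K : R) :
  (forall n, `|u n| <= K) -> u n @[n --> \oo] --> l -> `|l| <= K.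
Proof.
by move=> uK /cvg_norm/cvgr_to_le; apply; near=> n; exact: uK.
Unshelve. all: by end_near. Qed.

Lemma pointwise_limit_linear (Z : nat -> {linear V -> V}) :
    (forall x, cvgn (fun n => Z n x)) ->
  exists L : {linear V -> V}, forall x, Z n x @[n --> \oo] --> L x.
Proof.
move=> Zc; pose L x := limn (fun n => Z n x).
have Llin : linear L.
  move=> a x y; apply: norm_cvg_lim.
  under eq_cvg do rewrite linearP.
  by apply: cvgD; [apply: cvgZl_tmp|]; exact: Zc.
pose lL := GRing.isLinear.Build R V V _ L Llin.
pose L' : {linear V -> V} := HB.pack L lL.
by exists L' => x; exact: Zc.
Qed.

Lemma geometric_cvg (u : nat -> V) (K r : R) :
    0 <= r < 1 -> (forall n, `|u n.+1 - u n| <= K * r ^+ n) ->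
  cvgn u.
Proof.
move=> /andP[r0 r1] ur.
have -> : u = (fun n => u 0%N + series (fun k => u k.+1 - u k) n).
  by apply: funext => n; rewrite /series /= telescope_sumr // addrC subrK.
apply: is_cvgD; first exact: is_cvg_cst.
apply: normed_cvg; apply: series_le_cvg (_ : cvgn (series (geometric K r))).
- by move=> n /=.
- move=> n; rewrite /= mulr_ge0 ?exprn_ge0 //.
  by have := le_trans (normr_ge0 _) (ur 0%N); rewrite expr0 mulr1.
- exact: ur.
- by apply: is_cvg_geometric_series; rewrite ger0_norm.
Qed.

End OperatorLimits.

(** * Square roots of positive operators *)

Section SquareRoot.
Context {R : realType} {V : hilbertType R}.
Implicit Types (x y z : V).

Definition symmetric_operator (T : V -> V) : Prop :=
  forall x y, '[T x, y] = '[x, T y].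

(** The partial sums of the Neumann series satisfy N' = 1 + Y N, and converge
    geometrically. *)
Lemma neumann_inverse (Y : {linear V -> V}) (r : R) :
    0 <= r < 1 -> (forall x, `|Y x| <= r * `|x|) ->
  exists P : {linear V -> V},
    [/\ forall x, P x - Y (P x) = x, forall x, P (x - Y x) = x &
        forall x, `|P x| <= `|x| / (1 - r)].
Proof.
move=> r01 YK; have /andP[r0 r1] := r01.
pose N n : {linear V -> V} :=
  iter n (fun P : {linear V -> V} => idfun \+ (Y \o P)) \0.
have NS n x : N n.+1 x = x + Y (N n x) by [].
have Nstep n x : `|N n.+1 x - N n x| <= `|x| * r ^+ n.
  elim: n => [|n IHn]; first by rewrite NS /= linear0 addr0 subr0 mulr1.
  rewrite NS (NS n) opprD addrACA subrr add0r -linearB exprS mulrCA.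
  by apply: le_trans (YK _) _; rewrite ler_wpM2l.
have [P NP] := pointwise_limit_linear (fun x => geometric_cvg r01 (Nstep^~ x)).
have PY x : P x = x + Y (P x).
  have := NP x; rewrite -(cvg_shiftS (fun n => N n x)) => NSx.
  apply: (limit_unique NSx); under eq_cvg do rewrite NS.
  by apply: cvgD; [exact: cvg_cst|exact: (bounded_linear_cvg r0 YK)].
have r1' : 0 < 1 - r by rewrite subr_gt0.
have PS x : P x - Y (P x) = x by rewrite {1}PY addrK.
have PK x : `|P x| <= `|x| / (1 - r).
  rewrite ler_pdivlMr // mulrBr mulr1 lerBlDr {1}PY.
  by apply: le_trans (ler_normD _ _) _; rewrite lerD2l mulrC.
exists P; split=> // x; apply/eqP; rewrite -subr_eq0; apply/eqP.
set z := P _ - x; have zY : z = Y z.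
  by rewrite /z (linearB Y) {1}PY addrAC (addrAC x) subrr add0r addrC.
apply: normr0_eq0; apply/eqP; rewrite eq_le normr_ge0 andbT.
rewrite -(ler_pM2l r1') mulr0 mulrBl mul1r subr_le0.
by rewrite {1}zY.
Qed.

(** A square root of 1 - B of the form S = 1 - Y, where S^2 = 1 - B means
    Y = (B + Y^2) / 2.  The map on the right sends operators of norm at most r
    to operators of norm at most r, where it contracts distances by r. *)
Lemma sqrt_operator (B : {linear V -> V}) (r : R) :
    0 <= r < 1 -> symmetric_operator B -> (forall x, `|B x| <= r * `|x|) ->
  exists S P : {linear V -> V},
    [/\ symmetric_operator S, forall x, S (S x) = x - B x,
        cancel S P, cancel P S &
        (forall x, `|S x| <= 2 * `|x|) /\ forall x, `|P x| <= `|x| / (1 - r)].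
Proof.
move=> r01 Bsym BK; have /andP[r0 r1] := r01.
pose Z n : {linear V -> V} :=
  iter n (fun Y : {linear V -> V} => 2^-1 \*: (B \+ (Y \o Y))) \0.
have ZS n x : Z n.+1 x = 2^-1 *: (B x + Z n (Z n x)) by [].
have ZK n x : `|Z n x| <= r * `|x|.
  elim: n x => [|n IHn] x; first by rewrite normr0 mulr_ge0.
  rewrite ZS normrZ gtr0_norm // mulrC ler_pdivrMr //.
  apply: le_trans (ler_normD _ _) _; rewrite mulr2n mulrDr mulr1 lerD //.
  apply: le_trans (IHn _) _; rewrite ler_wpM2l //.
  by apply: le_trans (IHn _) _; rewrite ler_piMl // ltW.
have Zstep n x : `|Z n.+1 x - Z n x| <= `|x| * r ^+ n.
  elim: n x => [|n IHn] x.
    rewrite subr0 mulr1; apply: le_trans (ZK 1%N x) _.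
    by rewrite ler_piMl // ltW.
  rewrite ZS (ZS n) -scalerBr opprD addrACA subrr add0r.
  rewrite normrZ gtr0_norm // mulrC ler_pdivrMr //.
  have -> : Z n.+1 (Z n.+1 x) - Z n (Z n x)
          = Z n.+1 (Z n.+1 x - Z n x) + (Z n.+1 (Z n x) - Z n (Z n x)).
    by rewrite linearB addrA subrK.
  apply: le_trans (ler_normD _ _) _; rewrite mulr2n mulrDr mulr1 lerD //.
    apply: le_trans (ZK _ _) _; rewrite exprS mulrCA ler_wpM2l //.
  apply: le_trans (IHn _) _; rewrite exprS mulrA ler_wpM2r ?exprn_ge0 //.
  by rewrite mulrC ZK.
have Zsym n : symmetric_operator (Z n).
  elim: n => [|n IHn] x y; first by rewrite inner0l inner0r.
  by rewrite !ZS !innerE Bsym IHn IHn.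
have [Y ZY] := pointwise_limit_linear (fun x => geometric_cvg r01 (Zstep^~ x)).
have YK x : `|Y x| <= r * `|x| by apply: limit_norm_le (ZY x) => n.
have YE x : Y x = 2^-1 *: (B x + Y (Y x)).
  have := ZY x; rewrite -(cvg_shiftS (fun n => Z n x)) => ZSx.
  apply: (limit_unique ZSx); under eq_cvg do rewrite ZS.
  apply: cvgZl_tmp; apply: cvgD; first exact: cvg_cst.
  have -> : (fun n => Z n (Z n x))
          = (fun n => Z n (Z n x - Y x) + Z n (Y x)).
    by apply: funext => n; rewrite linearB subrK.
  rewrite -[Y (Y x)]add0r; apply: cvgD; last exact: ZY.
  apply: (lipschitz_cvg r0) (ZY x) => n.
  by rewrite sub0r normrN distrC.
have Ysym : symmetric_operator Y.
  move=> x y; apply: (limit_unique (inner_cvgl (y := y) (ZY x))).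
  under eq_cvg do rewrite Zsym innerC.
  by rewrite innerC; exact: inner_cvgl.
have [P [SP PS PK]] := neumann_inverse r01 YK.
exists (idfun \- Y), P; split=> //=.
- by move=> x y; rewrite !innerE Ysym.
- move=> x; rewrite linearB /= opprB.
  have h : Y x + Y x = B x + Y (Y x).
    by rewrite {1 2}YE -mulr2n -scaler_nat scalerA divff ?scale1r.
  by rewrite addrACA -opprD h opprD (addrC (- B x)) addrA addrK.
- split=> // x; apply: le_trans (ler_normB _ _) _.
  rewrite mulr_natl mulr2n lerD2l; apply: le_trans (YK _) _.
  by rewrite ler_piMl // ltW.
Qed.

End SquareRoot.

(** * Midpoints and convergence of tensors *)

Section TensorMaps.
Context {R : realType} {V : hilbertType R}.
Implicit Types (s t : seq (R * V)) (x y : V) (f : V -> V).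

Definition midpoint s t := scale 2^-1 (s ++ t).

Definition difference s t := s ++ scale (-1) t.

Lemma push_cat f s t : push f (s ++ t) = push f s ++ push f t.
Proof. exact: map_cat. Qed.

Lemma push_scale f a s : push f (scale a s) = scale a (push f s).
Proof. by rewrite /push /scale -!map_comp. Qed.

Lemma push_cancel f g s : cancel g f -> push f (push g s) = s.
Proof.
move=> fg; rewrite /push -map_comp -[RHS]map_id.
by apply: eq_map => -[a b] /=; rewrite fg.
Qed.

Lemma push_difference f s t :
  push f (difference s t) = difference (push f s) (push f t).
Proof. by rewrite push_cat push_scale. Qed.

(** This identity is the uniform convexity of the squared Hilbert-Schmidt
    norm. *)
Lemma hs_parallelogram s t :
  hs (difference s t) (difference s t) =
    2 * (hs s s + hs t t) - 4 * hs (midpoint s t) (midpoint s t).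
Proof. by rewrite !hsE (hsC t s); field. Qed.

Lemma tensor_op_difference s t x :
  tensor_op (difference s t) x = tensor_op s x - tensor_op t x.
Proof. by rewrite tensor_op_cat tensor_op_scale scaleN1r. Qed.

Lemma tensor_op_cvgB (s t : nat -> seq (R * V)) (K : R) x :
    (forall n,
      hs (difference (s n) (t n)) (difference (s n) (t n)) <= K / n.+1%:R) ->
  tensor_op (s n) x - tensor_op (t n) x @[n --> \oo] --> 0.
Proof.
move=> stK; apply/cvgrPdist_le => /= e e0; near=> n.
rewrite sub0r normrN -tensor_op_difference.
rewrite -(ler_pXn2r (n := 2)) ?nnegrE ?(ltW e0) //.
apply: le_trans (tensor_op_norm _ _) _.
apply: le_trans (ler_wpM2r (sqr_ge0 _) (stK n)) _.
rewrite mulrAC ler_pdivrMr // -ler_pdivrMl ?exprn_gt0 //.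
near: n; exists (Num.truncn ((e ^+ 2)^-1 * (K * `|x| ^+ 2))) => // n /= hn.
apply/ltW/(lt_le_trans (Num.Theory.truncnS_gt _)).
by rewrite ler_nat ltnS.
Unshelve. all: by end_near. Qed.

Lemma tensor_op_cvg (s : nat -> seq (R * V)) (K : R) x :
    (forall n m, (n <= m)%N ->
      hs (difference (s n) (s m)) (difference (s n) (s m)) <= K / n.+1%:R) ->
  cvgn (fun n => tensor_op (s n) x).
Proof.
move=> sK; apply/cauchy_cvgP/cauchyP => e e0.
pose N := Num.truncn ((e ^+ 2)^-1 * (K * `|x| ^+ 2)).
exists (tensor_op (s N) x); exists N => // n /= Nn.
rewrite -ball_normE /= -tensor_op_difference.
rewrite -(ltr_pXn2r (n := 2)) ?nnegrE ?(ltW e0) //.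
apply: le_lt_trans (tensor_op_norm _ _) _.
apply: le_lt_trans (ler_wpM2r (sqr_ge0 _) (sK _ _ Nn)) _.
rewrite mulrAC ltr_pdivrMr // -ltr_pdivrMl ?exprn_gt0 //.
exact: Num.Theory.truncnS_gt.
Qed.

End TensorMaps.

(** * Minimization over an invariant convex set of tensors *)

Section InvariantTensors.
Context {R : realType} {V : hilbertType R} {G : groupType}.
Variables (pi : representation G V) (M : R).
Hypothesis piM : forall g x, `|pi g x| <= M * `|x|.

Lemma repK g : cancel (pi g) (pi g^-1%g).
Proof. by move=> x; rewrite -repM mulVg rep1. Qed.

Lemma repVK g : cancel (pi g^-1%g) (pi g).
Proof. by move=> x; rewrite -repM mulgV rep1. Qed.

Lemma push_repM g h s : push (pi g) (push (pi h) s) = push (pi (g * h)%g) s.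
Proof.
by rewrite /push -map_comp; apply: eq_map => -[a b] /=; rewrite repM.
Qed.

(** A minimizing sequence of s |-> sup_g |g s|^2 on an invariant set closed
    under midpoints.  If s and t almost minimize, some g makes the midpoint of
    g s and g t at least almost as long as the infimum, so that g s and g t are
    close by the parallelogram identity, and s and t too because the action of
    g^-1 is bounded.  This applies to two terms of the sequence, and to a term
    and its translates, which almost minimize equally well. *)
Lemma almost_invariant_tensors (D : set (seq (R * V))) :
    D !=set0 -> (forall g s, D s -> D (push (pi g) s)) ->
    (forall s t, D s -> D t -> D (midpoint s t)) ->
  exists K : R, exists u : nat -> seq (R * V),
    [/\ forall n, D (u n),
        forall n m, (n <= m)%N ->
          hs (difference (u n) (u m)) (difference (u n) (u m)) <= K / n.+1%:R &
        forall g n, hs (difference (push (pi g) (u n)) (u n))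
          (difference (push (pi g) (u n)) (u n)) <= K / n.+1%:R].
Proof.
move=> [s0 Ds0] Dpush Dmid.
pose bound a s := forall g, hs (push (pi g) s) (push (pi g) s) <= a.
pose E := [set a | exists2 s, D s & bound a s].
have hE : has_inf E.
  split; first by exists (M ^+ 4 * hs s0 s0), s0 => // g; exact: hs_push.
  by exists 0 => a [s _ /(_ 1%g)]; apply: le_trans; exact: hs_ge0.
have close s t e : 0 < e -> D s -> D t -> bound (inf E + e) s ->
    bound (inf E + e) t ->
  hs (difference s t) (difference s t) <= M ^+ 4 * 8 * e.
  move=> e0 Ds Dt bs bt.
  have : ~ bound (inf E - e) (midpoint s t).
    move=> bm; have : inf E <= inf E - e.
      apply: ge_inf; first exact: hE.2.
      by exists (midpoint s t) => //; exact: Dmid.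
    by rewrite lerDl oppr_ge0 leNgt e0.
  move=> /existsNP[g /negP]; rewrite -ltNge => hg.
  rewrite -[difference s t](push_cancel _ (repK g)).
  apply: le_trans (hs_push _ (piM _)) _.
  rewrite -mulrA ler_wpM2l ?exprn_even_ge0 //.
  rewrite push_difference hs_parallelogram; move: hg.
  rewrite /midpoint push_scale push_cat -/(midpoint _ _).
  by have := bs g; have := bt g; lra.
have hu n : exists s, D s /\ bound (inf E + n.+1%:R^-1) s.
  have n0 : 0 < n.+1%:R^-1 :> R by rewrite invr_gt0.
  have [a [s Ds bs] al] := inf_adherent n0 hE.
  by exists s; split=> // g; apply: le_trans (bs g) (ltW al).
have {hu} [u hu] := choice hu.
exists (M ^+ 4 * 8), u; split=> [n|n m nm|g n]; first by case: (hu n).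
- have [Dn bn] := hu n; have [Dm bm] := hu m.
  apply: close => // g; apply: le_trans (bm g) _.
  by rewrite lerD2l lef_pV2 ?posrE // ler_nat.
- have [Dn bn] := hu n.
  apply: close => //; first exact: Dpush.
  by move=> h; rewrite push_repM; exact: bn.
Qed.

End InvariantTensors.

(** * Orthogonal projections onto finite-dimensional subspaces *)

Section FundamentalSymmetry.
Context {R : realType} {V : hilbertType R}.

Definition tensor_linear (s : seq (R * V)) : {linear V -> V} :=
  HB.pack (tensor_op s)
    (GRing.isLinear.Build R V V _ (tensor_op s) (tensor_op_linear s)).

Lemma tensor_op_symmetric (s : seq (R * V)) : symmetric_operator (tensor_op s).
Proof.
move=> x y; rewrite [RHS]innerC !inner_tensor_op.
by apply: eq_bigr => p _; rewrite mulrAC.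
Qed.

(** The Gram-Schmidt process, with the projection in place of the orthonormal
    basis.  A vector e dependent on the others has residue r = 0; the new
    coefficient 0^-1 = 0 then adds nothing to the tensor. *)
Lemma gram_schmidt (K : set V) (l : seq V) :
    GRing.submod_closed [in K] -> {in l, forall e, K e} ->
  exists s : seq (R * V),
    [/\ forall x, K (tensor_op s x),
        forall x y, '[x - tensor_op s x, tensor_op s y] = 0 &
        {in l, forall e x, '[x - tensor_op s x, e] = 0}].
Proof.
move=> Ksub; have [K0 _] := Ksub.
have Klin a x y : K x -> K y -> K (a *: x + y).
  by move=> Kx Ky; have [_ /(_ a x y)] := Ksub; rewrite !inE; exact.
elim: l => [|e l IHl] Kl.
  exists [::]; rewrite /tensor_op; split=> [x|x y|//]; rewrite !big_nil.
    by move: K0; rewrite inE.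
  by rewrite inner0r.
have [s [Ks sO lO]] := IHl (fun f fl => Kl f (mem_behead (s := e :: l) fl)).
have [r rE] : exists r, r = e - tensor_op s e by exists (e - tensor_op s e).
pose al x := '[r, r]^-1 * '[r, x].
have Ke : K e by apply: Kl; rewrite mem_head.
exists (('[r, r]^-1, r) :: s).
have TE x : tensor_op (('[r, r]^-1, r) :: s) x = al x *: r + tensor_op s x.
  by rewrite /tensor_op big_cons.
have sr x : '[tensor_op s x, r] = 0 by rewrite innerC rE sO.
have old z x : '[r, z] = 0 -> '[x - tensor_op s x, z] = 0 ->
    '[x - (al x *: r + tensor_op s x), z] = 0.
  by move=> rz; rewrite !innerE rz => h; lra.
have new x : '[x - (al x *: r + tensor_op s x), r] = 0.
  rewrite !innerE sr /al; have [r0|r0] := eqVneq '[r, r] 0.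
    by rewrite (inner_eq0 r0) !inner0r; ring.
  by rewrite mulrAC mulVf // mul1r (innerC x); ring.
split.
- move=> x; rewrite TE; apply: (Klin) => //.
  by rewrite rE -scaleN1r addrC; exact: Klin.
- by move=> x y; rewrite !TE innerDr innerZr new old ?rE ?sO // mulr0 addr0.
- move=> f; rewrite inE => /orP[/eqP -> x|fl x]; rewrite TE.
    have -> : e = r + tensor_op s e by rewrite rE subrK.
    by rewrite innerDr new old ?rE ?sO // addr0.
  by rewrite old ?rE ?lO.
Qed.

Lemma projection_tensor (K : set V) (P : V -> V) :
    GRing.submod_closed [in K] -> finite_dimensional K ->
    is_orthogonal_projection K P ->
  exists s : seq (R * V), forall x, tensor_op s x = P x.
Proof.
move=> Ksub [n [e KE]] Pproj.
have Ke : {in codom e, forall f, K f}.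
  move=> _ /codomP[i ->]; rewrite KE; exists (fun j => (j == i)%:R) => //.
  rewrite (bigD1 i) //= eqxx scale1r big1 ?addr0 // => j /negPf ->.
  by rewrite scale0r.
have [s [Ks sO lO]] := gram_schmidt Ksub Ke.
exists s => x; apply/eqP; rewrite -subr_eq0; apply/eqP/inner_eq0.
have KO z y : K y -> '[z - tensor_op s z, y] = 0.
  rewrite {1}KE => -[c _ <-]; rewrite inner_sumr big1 // => i _.
  by rewrite innerZr lO ?mulr0 // codom_f.
have [KP PO] := Pproj x; set z := tensor_op s x - P x.
have Kz : K z.
  have [_ /(_ (-1) (P x) (tensor_op s x))] := Ksub.
  by rewrite !inE scaleN1r addrC; exact.
rewrite {1}/z; have -> : tensor_op s x - P x = (x - P x) - (x - tensor_op s x).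
    by rewrite opprB [RHS]addrC addrA subrK.
by rewrite innerDl innerNl PO // KO // subr0.
Qed.

(** The difference of the two sides is orthogonal to H and to K. *)
Lemma projection_complement (H K : set V) (PH PK : V -> V) :
    orthogonal_sum H K -> is_orthogonal_projection H PH ->
    is_orthogonal_projection K PK ->
  forall x, PH x = x - PK x.
Proof.
move=> [_ _ HK dec] PHp PKp x; apply: inner_inj => z.
have [h [k [Hh Kk ->]]] := dec z.
have [HPx /(_ h Hh)] := PHp x; have [KPx /(_ k Kk)] := PKp x.
have := HK _ _ HPx Kk; have := HK _ _ Hh KPx.
by rewrite !innerE (innerC h) => *; lra.
Qed.

End FundamentalSymmetry.

(** * An invariant positive definite form *)

Section Invariance.
Context {R : realType} {V : hilbertType R} {G : groupType}.
Variables (pi : representation G V).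

(** Adding 2 |P_K x|^2 to (J x, x) gives back |x|^2.  The correction, whose
    tensor [s] is that of P_K, is written as a form in J x because it is the
    form (J x, y), and not the inner product, that pi(g) preserves. *)
Lemma fundamental_symmetry :
    preserves_form_with_finite_negative_squares pi ->
  exists (J : {linear V -> V}) (s : seq (R * V)),
    [/\ symmetric_operator J,
        forall g x y, '[J (pi g x), pi g y] = '[J x, y] &
        forall x, '[J x, x] + 2 * '[tensor_op s (J x), J x] = '[x, x]].
Proof.
move=> [H [K [PH [PK [HK Kfin PHp PKp form]]]]].
have [_ Ksub _ _] := HK.
have [s sP] := projection_tensor Ksub Kfin PKp.
have PHE := projection_complement HK PHp PKp.
have PP x : PK (PK x) = PK x.
  have [KPx _] := PKp x; have [KPP PPO] := PKp (PK x).
  apply/eqP; rewrite eq_sym -subr_eq0; apply/eqP/inner_eq0.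
  by rewrite innerDr innerNr !PPO // subrr.
have Psym x y : '[PK x, y] = '[x, PK y] by rewrite -!sP tensor_op_symmetric.
pose J : {linear V -> V} := idfun \- 2 \*: tensor_linear s.
have JE x : J x = x - 2 *: PK x by rewrite /= sP.
have PJ x : PK (J x) = - PK x.
  rewrite JE addrC -scaleNr -sP tensor_op_linear !sP PP.
  by rewrite scaleNr scaler_nat mulr2n opprD subrK.
exists J, s; split.
- by move=> x y; rewrite !JE !innerE Psym.
- move=> g x y; have := form x y g; rewrite !PHE !JE !innerE => h; lra.
- move=> x; rewrite sP PJ JE !innerE -!Psym PP; ring.
Qed.

(** The set to minimize over consists of the tensors T such that, after any
    translation of T by the group, (J x, x) + 2 (T J x, J x) lies between
    M^-2 |x|^2 and M^2 |x|^2.  The operator is A = J + 2 J L J, where L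
    is the limit of the operators of a minimizing sequence. *)
Lemma invariant_form (M : R) :
    0 < M -> (forall g x, `|pi g x| <= M * `|x|) ->
    preserves_form_with_finite_negative_squares pi ->
  exists (A : {linear V -> V}) (c C : R),
    [/\ symmetric_operator A, 0 < c,
        forall x, c * '[x, x] <= '[A x, x],
        forall x, '[A x, x] <= C * '[x, x] &
        forall g x y, '[A (pi g x), pi g y] = '[A x, y]].
Proof.
move=> M0 piM /fundamental_symmetry [J [s0 [Jsym Jinv Js0]]].
pose q s x := '[J x, x] + 2 * '[tensor_op s (J x), J x].
have pushJ g s x y : '[tensor_op (push (pi g) s) (J x), J y] =
    '[tensor_op s (J (pi g^-1%g x)), J (pi g^-1%g y)].
  have bJ b z : '[pi g b, J z] = '[b, J (pi g^-1%g z)].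
    by rewrite -!Jsym -{1}(repVK pi g z) Jinv.
  by rewrite !inner_tensor_op big_map; apply: eq_bigr => p _ /=; rewrite !bJ.
have qpush g s x : q (push (pi g) s) x = q s (pi g^-1%g x).
  by rewrite /q pushJ Jinv.
have M2 : 0 < M ^+ 2 by rewrite exprn_gt0.
have pi2 g x : '[pi g x, pi g x] <= M ^+ 2 * '[x, x].
  by rewrite !inner_norm -exprMn ler_pXn2r ?nnegrE ?mulr_ge0 // ltW.
pose D : set (seq (R * V)) := [set s | forall g x,
  (M ^+ 2)^-1 * '[x, x] <= q (push (pi g) s) x <= M ^+ 2 * '[x, x]].
have D0 : D !=set0.
  exists s0 => g x; rewrite qpush /q Js0; apply/andP; split=> //.
  by rewrite ler_pdivrMl // -{1 2}(repVK pi g x).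
have Dpush g s : D s -> D (push (pi g) s).
  by move=> Ds h x; rewrite push_repM; exact: Ds.
have Dmid s t : D s -> D t -> D (midpoint s t).
  move=> Ds Dt g x.
  have -> : q (push (pi g) (midpoint s t)) x
          = 2^-1 * (q (push (pi g) s) x + q (push (pi g) t) x).
    rewrite /q push_scale push_cat tensor_op_scale tensor_op_cat !innerE.
    by lra.
  have /andP[? ?] := Ds g x; have /andP[? ?] := Dt g x.
  by apply/andP; split; lra.
have [K [u [Du ucauchy uinv]]] := almost_invariant_tensors piM D0 Dpush Dmid.
have [L uL] := pointwise_limit_linear
  (Z := fun n => tensor_linear (u n)) (fun x => tensor_op_cvg (x := x) ucauchy).
have uLi x y : '[tensor_op (u n) x, y] @[n --> \oo] --> '[L x, y].
  exact: inner_cvgl (uL x).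
have Lsym : symmetric_operator L.
  move=> x y; apply: limit_unique (uLi x y) _.
  under eq_cvg do rewrite tensor_op_symmetric innerC.
  by rewrite innerC; exact: uLi.
have Linv g x y : '[L (J (pi g x)), J (pi g y)] = '[L (J x), J y].
  apply: limit_unique (uLi _ _) _.
  (* moving g across replaces u n by a translate, which has the same limit *)
  have -> : (fun n => '[tensor_op (u n) (J (pi g x)), J (pi g y)])
    = (fun n => '[tensor_op (push (pi g^-1%g) (u n)) (J x)
                  - tensor_op (u n) (J x), J y]
                + '[tensor_op (u n) (J x), J y]).
    by apply: funext => n; rewrite -innerDl subrK pushJ invgK.
  rewrite -[X in _ --> X]add0r -{1}(inner0l (J y)); apply: cvgD (uLi _ _).
  exact: inner_cvgl (tensor_op_cvgB _ (uinv _)).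
pose A : {linear V -> V} := J \+ 2 \*: (J \o (L \o J)).
have AE x y : '[A x, y] = '[J x, y] + 2 * '[L (J x), J y].
  by rewrite /A /= !innerE (Jsym (L _)).
have uA x : q (u n) x @[n --> \oo] --> '[A x, x].
  rewrite AE; apply: cvgD; first exact: cvg_cst.
  by apply: cvgMl_tmp; exact: uLi.
have Du1 n x : (M ^+ 2)^-1 * '[x, x] <= q (u n) x <= M ^+ 2 * '[x, x].
  by have := Du n 1%g x; rewrite qpush invg1 rep1.
exists A, (M ^+ 2)^-1, (M ^+ 2); split.
- move=> x y; rewrite [RHS]innerC !AE Jsym Lsym.
  by rewrite (innerC (J y)) (innerC (L _)).
- by rewrite invr_gt0.
- move=> x; apply: cvgr_to_ge (uA x) _; near=> n.
  by have /andP[] := Du1 n x.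
- move=> x; apply: cvgr_to_le (uA x) _; near=> n.
  by have /andP[] := Du1 n x.
- by move=> g x y; rewrite !AE Jinv Linv.
Unshelve. all: by end_near. Qed.

End Invariance.

(** * Operator norms *)

Section OperatorNorm.
Context {R : realType} {V : normedModType R}.

Lemma bounded_operator_of_le (T : {linear V -> V}) (K : R) :
  0 <= K -> (forall x, `|T x| <= K * `|x|) -> bounded_operator T.
Proof.
move=> K0 TK; apply: (@le_lt_trans _ _ K%:E); last exact: ltry.
apply: ge_ereal_sup => _ [x /= x1 <-]; rewrite lee_fin.
by apply: le_trans (TK x) _; rewrite ler_piMr.
Qed.

Lemma norm_le_opnorm (T : {linear V -> V}) (K : R) x :
  (opnorm T <= K%:E)%E -> `|T x| <= K * `|x|.
Proof.
move=> TK; have [->|x0] := eqVneq x 0; first by rewrite linear0 !normr0 mulr0.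
have nx : 0 < `|x| by rewrite normr_gt0.
have : (`|T (`|x|^-1 *: x)|%:E <= K%:E)%E.
  apply: le_trans TK; apply: ereal_sup_ubound; exists (`|x|^-1 *: x) => //=.
  by rewrite normrZ normfV normr_id mulVf // gt_eqF.
by rewrite lee_fin linearZ /= normrZ normfV normr_id ler_pdivrMl // mulrC.
Qed.

End OperatorNorm.

(** * Similarity to an orthogonal representation *)

Section Similarity.
Context {R : realType} {V : hilbertType R} {G : groupType}.
Variables (pi : representation G V).

Lemma uniform_bound : bounded_representation pi ->
  exists2 M : R, 0 < M & forall g x, `|pi g x| <= M * `|x|.
Proof.
rewrite /bounded_representation; set S := ereal_sup _ => Soo.
have Sub g : (opnorm (pi g) <= S)%E by apply: ereal_sup_ubound; exists g.
have S0 : (0 <= S)%E.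
  apply: le_trans (Sub 1%g); apply: ereal_sup_ubound; exists 0 => /=.
    by rewrite normr0.
  by rewrite linear0 normr0.
have SE : S = (fine S)%:E by rewrite fineK // ge0_fin_numE.
exists (fine S + 1); first by rewrite ltr_wpDl // fine_ge0.
move=> g x; apply: norm_le_opnorm; apply: le_trans (Sub g) _.
by rewrite SE lee_fin lerDl.
Qed.

(** Apply the Cauchy-Schwarz inequality of the form (B x, y) to the vectors x
    and B x. *)
Lemma symmetric_operator_norm_le (B : {linear V -> V}) (r : R) :
    0 <= r -> symmetric_operator B ->
    (forall x, 0 <= '[B x, x] <= r * '[x, x]) ->
  forall x, `|B x| <= r * `|x|.
Proof.
move=> r0 Bsym Br x.
rewrite -(ler_pXn2r (n := 2)) ?nnegrE ?mulr_ge0 // exprMn -!inner_norm.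
have [->|w0] := eqVneq '[B x, B x] 0.
  by rewrite mulr_ge0 ?sqr_ge0 ?inner_ge0.
have {w0} wgt0 : 0 < '[B x, B x] by rewrite lt_def w0 inner_ge0.
have /andP[a0 ar] := Br x; have /andP[c0 cr] := Br (B x).
have h : '[B x, B x] ^+ 2 <= '[B x, x] * '[B (B x), B x].
  apply: discriminant_le0 => // t; have /andP[+ _] := Br (x + t *: B x).
  rewrite linearD linearZ /= !innerE (Bsym (B x)).
  by congr (0 <= _); ring.
have := ler_pM a0 c0 ar cr => h2.
by rewrite -(ler_pM2r wgt0); lra.
Qed.

(** If S^2 = A / D, then S maps the invariant form to a multiple of the inner
    product, so that S pi(g) S^-1 is orthogonal. *)
Lemma similar_of_invariant_form (M : R) (A : {linear V -> V}) (c C : R) :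
    0 <= M -> (forall g x, `|pi g x| <= M * `|x|) ->
    symmetric_operator A -> 0 < c ->
    (forall x, c * '[x, x] <= '[A x, x]) ->
    (forall x, '[A x, x] <= C * '[x, x]) ->
    (forall g x y, '[A (pi g x), pi g y] = '[A x, y]) ->
  exists tau : representation G V,
    orthogonal_representation tau /\ similar_representations pi tau.
Proof.
move=> M0 piM Asym c0 cA AC Ainv.
(* the bound C could be smaller than c if V is trivial *)
pose D := Num.max C c.
have D0 : 0 < D by rewrite lt_max c0 orbT.
have AD x : '[A x, x] <= D * '[x, x].
  by apply: le_trans (AC x) _; rewrite ler_wpM2r ?inner_ge0 // le_max lexx.
have cD : c <= D by rewrite le_max lexx orbT.
pose r := 1 - c / D.
have r01 : 0 <= r < 1.
  by rewrite subr_ge0 ler_pdivrMr // mul1r cD gtrDl oppr_lt0 divr_gt0.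
have /andP[r0 r1] := r01.
pose B : {linear V -> V} := idfun \- D^-1 \*: A.
have BE x : B x = x - D^-1 *: A x by [].
have Bsym : symmetric_operator B by move=> x y; rewrite !BE !innerE Asym.
have BK : forall x, `|B x| <= r * `|x|.
  apply: symmetric_operator_norm_le => // x; rewrite BE !innerE.
  rewrite subr_ge0 ler_pdivrMl // AD /= /r mulrBl mul1r lerD2l lerN2.
  by rewrite mulrAC mulrC ler_pM2l ?invr_gt0.
have [S [P [Ssym SS SP PS [S2 PK]]]] := sqrt_operator r01 Bsym BK.
have SSA x : S (S x) = D^-1 *: A x by rewrite SS BE subKr.
pose t g : {linear V -> V} := S \o (pi g \o P).
have tE g x : t g x = S (pi g (P x)) by [].
have r1' : 0 < 1 - r by rewrite subr_gt0.
have tb g : bounded_operator (t g).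
  apply: (@bounded_operator_of_le _ _ _ (2 * (M * (1 - r)^-1))).
    by rewrite !mulr_ge0 // invr_ge0 ltW.
  move=> x; apply: le_trans (S2 _) _; rewrite -mulrA ler_pM2l //.
  by apply: le_trans (piM _ _) _; rewrite -mulrA ler_wpM2l // mulrC.
have t1 x : t 1%g x = x by rewrite tE rep1.
have tM g h x : t (g * h)%g x = t g (t h x) by rewrite !tE repM SP.
exists (Representation tb t1 tM); split.
  move=> g /=; split.
    apply/seteqP; split=> // y _; exists (t g^-1%g y) => //.
    by rewrite -tM mulgV t1.
  move=> x y; rewrite !tE Ssym SSA innerZr -Asym Ainv Asym -innerZr -SSA.
  by rewrite -Ssym !PS.
exists P, S; split=> //.
- apply: (@bounded_operator_of_le _ _ _ (1 - r)^-1).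
    by rewrite invr_ge0 ltW.
  by move=> x; rewrite mulrC.
- exact: (@bounded_operator_of_le _ _ _ 2).
Qed.

End Similarity.

Theorem corollary5p3 (R : realType) (G : groupType) (V : hilbertType R)
    (pi : representation G V) :
  bounded_representation pi ->
  preserves_form_with_finite_negative_squares pi ->
  exists tau : representation G V,
    orthogonal_representation tau /\ similar_representations pi tau.
Proof.
move=> /uniform_bound[M M0 piM] piform.
have [A [c [C [Asym c0 cA AC Ainv]]]] := invariant_form M0 piM piform.
exact: similar_of_invariant_form (ltW M0) piM Asym c0 cA AC Ainv.
Qed.
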